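(* Let $\mathcal F$ be a filter on $\omega$ extending the cofinite filter. For every ${\bf\Sigma}^1_1$ set $A\subseteq\omega^\omega$, either there exists $H\in\mathbb H_{\mathcal F}$ with $[H]\cap A=\emptyset$, or there exists $L\in\mathbb L_{\mathcal F}$ with $[L]\subseteq A$.
   Context: A subtree of $\omega^{<\omega}$ is a nonempty subset closed under initial segments; $sn$ denotes the one-term extension of $s$ by $n$; $[T]=\{x\in\omega^\omega:\forall n\ x\upharpoonright n\in T\}$. $\mathcal F^+$ denotes the set of $X\subseteq\omega$ whose complement is not in $\mathcal F$. $\mathbb H_{\mathcal F}$ is the set of subtrees $H\subseteq\omega^{<\omega}$ such that for every $s\in H$, $\{n: sn\in H\}\in\mathcal F$. $\mathbb L_{\mathcal F}$ is the set of subtrees $L\subseteq\omega^{<\omega}$ such that for every $s\in L$, $\{n: sn\in L\}\in\mathcal F^+$. *)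

(* Defs.v *)
From HB Require Import structures.
From mathcomp Require Import all_boot all_order all_algebra.
From mathcomp Require Import all_classical all_reals topology.

Set Implicit Arguments.
Unset Strict Implicit.
Unset Printing Implicit Defensive.

Local Open Scope classical_set_scope.

(* The canonical topology on [nat] is the discrete one, so this is
   omega^omega with its usual product topology. *)
Notation baire := {ptws nat -> nat}.

Definition subtree (T : set (seq nat)) : Prop :=
  T !=set0 /\ forall s t : seq nat, prefix s t -> T t -> T s.

(* [mkseq x n] is the restriction of [x] to its first [n] values. *)
Definition branches (T : set (seq nat)) : set baire :=
  [set x : baire | forall n : nat, T (mkseq x n)].

Definition succs (T : set (seq nat)) (s : seq nat) : set nat :=
  [set n : nat | T (rcons s n)].

Definition positive (F : set_system nat) : set_system nat :=
  [set X : set nat | ~ F (~` X)].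

Definition HF (F : set_system nat) : set (set (seq nat)) :=
  [set H | subtree H /\ forall s, H s -> F (succs H s)].

Definition LF (F : set_system nat) : set (set (seq nat)) :=
  [set L | subtree L /\ forall s, L s -> positive F (succs L s)].

(* Boldface Sigma^1_1: projections of closed subsets of
   omega^omega x omega^omega. *)
Definition Sigma11 (A : set baire) : Prop :=
  exists C : set (baire * baire)%type,
    closed C /\ A = [set x : baire | exists y : baire, C (x, y)].

(* Main.v *)
Require Import Defs.
From HB Require Import structures.
From mathcomp Require Import all_boot all_order all_algebra.
From mathcomp Require Import all_classical all_reals topology.

Local Open Scope classical_set_scope.

(** Write [A] as the projection of a closed set [C].  A pair [(s, t)] is good
    when some [F]-branching tree above [s] has no branch [x] with [C (x, y)] for
    a [y] extending [t].  If [(s, t)] is bad, then no [F]-branching tree above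
    [s] avoids the nodes [u] such that [(u, rcons t m)] is bad for some
    [m <= size u]: otherwise each node would only require finitely many good
    trees to be intersected, and the result would witness that [(s, t)] is
    good.  By open determinacy, a positively branching tree above [s] leads to
    such nodes along all its branches.  If [([::], [::])] is bad, concatenating
    these trees gives [L], and the successive extensions of [t] met along a
    branch of [L] give the witness [y]. *)

(** * Plays and trees given by sets of allowed moves *)

Definition follows (tau : seq nat -> set nat) (k : nat) (x : nat -> nat) :=
  forall i, k <= i -> tau (mkseq x i) (x i).

(** Prescribing the allowed moves at every sequence, reachable or not, reduces membership in [HF] or
    [LF] to a condition on the values of [tau]. *)
Definition strategy_tree (tau : seq nat -> set nat) : set (seq nat) :=
  [set u | forall i, i < size u -> tau (take i u) (nth 0 u i)].

Lemma take_mkseq (x : nat -> nat) i n :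
  i <= n -> take i (mkseq x n) = mkseq x i.
Proof. by move=> ilen; rewrite /mkseq -map_take take_iota (minn_idPl ilen). Qed.

Lemma mkseq_inj_le (x x' : nat -> nat) n :
  mkseq x n = mkseq x' n -> forall i, i < n -> x i = x' i.
Proof.
by move=> e i iltn; have := congr1 (nth 0 ^~ i) e; rewrite !nth_mkseq.
Qed.

Lemma subtree_strategy_tree (tau : seq nat -> set nat) :
  subtree (strategy_tree tau).
Proof.
split; first by exists [::].
move=> s t /prefixP[r ->] st i ilts; have := st i.
rewrite size_cat (leq_trans ilts) ?leq_addr// nth_cat ilts.
by rewrite takel_cat ?(ltnW ilts)//; apply.
Qed.

Lemma succs_strategy_tree (tau : seq nat -> set nat) (s : seq nat) :
  strategy_tree tau s -> succs (strategy_tree tau) s = tau s.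
Proof.
move=> ts; apply/seteqP; split=> n.
  move=> /(_ (size s)); rewrite size_rcons ltnSn nth_rcons ltnn eqxx.
  by rewrite -cats1 take_size_cat//; apply.
move=> tn i; rewrite size_rcons ltnS leq_eqVlt => /orP[/eqP->|ilts].
  by rewrite nth_rcons ltnn eqxx -cats1 take_size_cat.
by rewrite nth_rcons ilts -cats1 takel_cat ?(ltnW ilts)//; exact: ts.
Qed.

Lemma branches_strategy_tree (tau : seq nat -> set nat) (x : baire) :
  branches (strategy_tree tau) x -> follows tau 0 x.
Proof.
move=> bx i _; have := bx i.+1 i; rewrite size_mkseq ltnSn nth_mkseq//.
by rewrite take_mkseq//; apply.
Qed.

(** * Open determinacy *)

Lemma not_positive (F : set_system nat) (X : set nat) :
  ~ positive F X -> F (~` X).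
Proof. by move=> /contrapT. Qed.

(* Open determinacy of the game in which one player proposes sets of [F], the
   other picks elements of them and wants to reach [B]. *)
Lemma reach_or_avoid (F : set_system nat) (F_filter : Filter F)
    (F_proper : ~ F set0) (B : set (seq nat)) (s : seq nat) :
  (exists2 tau, forall u, positive F (tau u) &
     forall x, mkseq x (size s) = s -> follows tau (size s) x ->
       exists2 i, size s < i & B (mkseq x i)) \/
  (exists2 sigma, forall u, F (sigma u) &
     forall x, mkseq x (size s) = s -> follows sigma (size s) x ->
       forall i, size s < i -> ~ B (mkseq x i)).
Proof.
(* [R] lets [B] be met at [u] itself, [W] only strictly later: the conclusion needs [W], while the
   passage to successors needs [R]. *)
pose R u := exists2 tau, forall v, positive F (tau v) &
  forall x, mkseq x (size u) = u -> follows tau (size u) x ->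
    exists2 i, size u <= i & B (mkseq x i).
pose W u := exists2 tau, forall v, positive F (tau v) &
  forall x, mkseq x (size u) = u -> follows tau (size u) x ->
    exists2 i, size u < i & B (mkseq x i).
have posT : positive F setT by rewrite /positive /= setCT.
have BR u : B u -> R u.
  by move=> Bu; exists (fun=> setT) => // x xu _; exists (size u); rewrite ?xu.
have WR u : W u -> R u.
  move=> [tau tp th]; exists tau => // x xu /(th x xu)[i /ltnW ui Bi].
  by exists i.
have RW u : positive F [set n | R (rcons u n)] -> W u.
  move=> Rp.
  have /choice[g gP] : forall n, exists tau, (forall v, positive F (tau v)) /\
      (R (rcons u n) -> forall x, mkseq x (size u).+1 = rcons u n ->
        follows tau (size u).+1 x ->
        exists2 i, size u < i & B (mkseq x i)).
    move=> n; have [[tau tp th]|nR] := pselect (R (rcons u n)).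
      by exists tau; split=> // _; rewrite size_rcons in th.
    by exists (fun=> setT).
  (* After a first move into [R], the entry of [v] at [size u] recalls which successor was chosen,
     hence which strategy to continue with. *)
  exists (fun v => if size v <= size u then [set n | R (rcons u n)]
                   else g (nth 0 v (size u)) v).
    by move=> v; case: ifP => // _; apply: (gP _).1.
  move=> x xu fx.
  have Rx : R (rcons u (x (size u))).
    by have := fx _ (leqnn _); rewrite size_mkseq leqnn.
  apply: ((gP _).2 Rx); first by rewrite mkseqS xu.
  move=> i ui; have := fx i (ltnW ui).
  by rewrite size_mkseq leqNgt ui /= nth_mkseq.
have [Ws|nWs] := pselect (W s); [by left|right].
have nW u : ~ W u -> F [set n | ~ R (rcons u n)].
  by move=> nWu; apply: not_positive => /RW.
(* The avoiding player keeps the play outside [R], which is possible wherever [W] fails; [setT] only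
   makes the strategy total. *)
exists (fun u => if `[< F [set n | ~ R (rcons u n)] >]
                 then [set n | ~ R (rcons u n)] else setT).
  by move=> u; case: asboolP => // _; exact: filterT.
move=> x xs fx.
suff nWx k : ~ W (mkseq x (size s + k)) /\ ~ R (mkseq x (size s + k).+1).
  move=> i si; have := (nWx (i - (size s).+1)).2.
  by rewrite -addSn subnKC// => nR /BR.
have step i : size s <= i -> ~ W (mkseq x i) -> ~ R (mkseq x i.+1).
  move=> si /nW Fi; have := fx i si.
  by case: asboolP => // _; rewrite mkseqS.
elim: k => [|k [_ nR]]; rewrite ?addn0 ?addnS.
  by rewrite xs; split=> //; apply: step => //; rewrite xs.
have nWk : ~ W (mkseq x (size s + k).+1) by move=> /WR.
by split=> //; apply: step => //; rewrite -addnS leq_addr.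
Qed.

(** * Finite intersections and bad pairs *)

Lemma filter_forall_leq (F : set_system nat) (F_filter : Filter F)
    (P : nat -> set nat) k :
  (forall i, F (P i)) -> F [set n | forall i, i <= k -> P i n].
Proof.
move=> FP; elim: k => [|k IH].
  by apply: filterS (FP 0) => n Pn i; rewrite leqn0 => /eqP->.
apply: filterS2 IH (FP k.+1) => n Pn PSn i.
by rewrite leq_eqVlt => /orP[/eqP->//|]; rewrite ltnS; exact: Pn.
Qed.

Definition bad (F : set_system nat) (C : set (baire * baire))
    (s t : seq nat) : Prop :=
  forall sigma, (forall u, F (sigma u)) ->
  exists x y : baire,
    [/\ mkseq x (size s) = s, mkseq y (size t) = t,
        follows sigma (size s) x & C (x, y)].

Definition bad_extension (F : set_system nat) (C : set (baire * baire))
    (t u : seq nat) : set nat :=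
  [set m | m <= size u /\ bad F C u (rcons t m)].

Lemma bad_reach (F : set_system nat) (F_filter : Filter F)
    (F_proper : ~ F set0) (C : set (baire * baire)) (s t : seq nat) :
  bad F C s t ->
  exists2 tau, forall u, positive F (tau u) &
    forall x, mkseq x (size s) = s -> follows tau (size s) x ->
      exists2 i, size s < i & bad_extension F C t (mkseq x i) !=set0.
Proof.
move=> bst.
have [//|[sigma sF sA]] := reach_or_avoid _ F_filter F_proper
  [set u | bad_extension F C t u !=set0] s.
have /choice[rho rhoP] : forall um : seq nat * nat, exists sg,
    (forall u, F (sg u)) /\
    (~ bad F C um.1 (rcons t um.2) -> forall x y : baire,
       mkseq x (size um.1) = um.1 -> mkseq y (size t).+1 = rcons t um.2 ->
       follows sg (size um.1) x -> ~ C (x, y)).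
  move=> [u m] /=; have [b|/existsNP[sg]] := pselect (bad F C u (rcons t m)).
    by exists (fun=> setT); split=> // v; exact: filterT.
  move=> /not_implyP[sgF ng]; exists sg; split=> // _ x y xu ym fx Cxy.
  by apply: ng; exists x, y; rewrite size_rcons.
(* Besides avoiding bad extensions, [Sg] obeys every good tree attached to a prefix of [u] and a
   number up to [size u]. *)
pose Sg u := sigma u `&`
  [set n | forall i, i <= size u -> forall m, m <= size u ->
     rho (take i u, m) u n].
have /bst[x [y [xs yt fx Cxy]]] : forall u, F (Sg u).
  move=> u; apply: filterI => //; apply: filter_forall_leq => i.
  by apply: filter_forall_leq => m; apply: (rhoP _).1.
set m := y (size t); set i := maxn (size s).+1 m.
have ngi : ~ bad F C (mkseq x i) (rcons t m).
  move=> b; apply: (sA x xs _ i); rewrite ?leq_maxl//.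
    by move=> j sj; have [] := fx j sj.
  by exists m; split=> //; rewrite size_mkseq leq_maxr.
exfalso; apply: ((rhoP (mkseq x i, m)).2 ngi x y) => //=.
- by rewrite size_mkseq.
- by rewrite mkseqS yt.
- rewrite size_mkseq => j ij; have [] := fx j.
    by apply: leq_trans ij; rewrite (leq_trans (leqnSn _))// leq_maxl.
  move=> _ /(_ i); rewrite size_mkseq take_mkseq// => /(_ ij m); apply.
  by rewrite (leq_trans _ ij)// leq_maxr.
Qed.

(** * Limits in the Baire space and the witness along a branch *)

Lemma ptws_cvg_mkseq (x : baire) (f : nat -> baire) :
  (forall n, mkseq (f n) n = mkseq x n) -> f n @[n --> \oo] --> x.
Proof.
move=> fx; apply/pointwise_cvgP => k; apply/discrete_cvg.
exists k.+1 => // n /= kn; exact: mkseq_inj_le (fx n) _ kn.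
Qed.

Lemma closed_baire2 (C : set (baire * baire)) (x y : baire) : closed C ->
  (forall n, exists x' y' : baire,
     [/\ C (x', y'), mkseq x' n = mkseq x n & mkseq y' n = mkseq y n]) ->
  C (x, y).
Proof.
move=> clC /choice[f /choice[g fgP]].
apply: (closed_cvg C clC (F := \oo) (u_ := fun n => (f n, g n))).
  by apply: nearW => n; have [] := fgP n.
have fx : f n @[n --> \oo] --> x by apply: ptws_cvg_mkseq => n; have [] := fgP n.
have gy : g n @[n --> \oo] --> y by apply: ptws_cvg_mkseq => n; have [] := fgP n.
exact: cvg_pair fx gy.
Qed.

(* [run ext u] is the last prefix of [u] at which the second component has been
   extended, paired with the value of this second component; [ext t u] is the
   set of the numbers by which [t] may be extended at [u]. *)
Definition run_step (ext : seq nat -> seq nat -> set nat)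
    (st : seq nat * seq nat) (u : seq nat) : seq nat * seq nat :=
  if `[< ext st.2 u !=set0 >] then (u, rcons st.2 (xget 0 (ext st.2 u)))
  else st.

Definition run (ext : seq nat -> seq nat -> set nat) (u : seq nat) :
    seq nat * seq nat :=
  (foldl (fun vst n => (rcons vst.1 n, run_step ext vst.2 (rcons vst.1 n)))
     ([::], ([::], [::])) u).2.

Lemma run_rcons (ext : seq nat -> seq nat -> set nat) (u : seq nat) n :
  run ext (rcons u n) = run_step ext (run ext u) (rcons u n).
Proof.
rewrite /run foldl_rcons /=; congr (run_step _ _ (rcons _ _)).
(* The first component of the fold is the prefix read so far. *)
elim/last_ind: u => // u m IH; rewrite foldl_rcons /=.
by rewrite {}IH.
Qed.

Lemma run_mkseqS (ext : seq nat -> seq nat -> set nat) (x : nat -> nat) i :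
  run ext (mkseq x i.+1) = run_step ext (run ext (mkseq x i)) (mkseq x i.+1).
Proof. by rewrite mkseqS run_rcons. Qed.

Lemma run_prefix (ext : seq nat -> seq nat -> set nat) (x : nat -> nat) i j :
  i <= j -> prefix (run ext (mkseq x i)).2 (run ext (mkseq x j)).2.
Proof.
move=> /subnKC <-; elim: (j - i) => [|k IH]; first by rewrite addn0 prefix_refl.
apply: prefix_trans IH _; rewrite addnS run_mkseqS /run_step.
by case: ifP => _; rewrite ?prefix_rcons ?prefix_refl.
Qed.

(** Invariants of the run, by induction on [i]. The last two say that since [st.1] a single strategy
    has been in use and has not yet reached its target. *)
Lemma run_bad (F : set_system nat) (C : set (baire * baire))
    (x : nat -> nat) i :
  bad F C [::] [::] ->
  let st := run (bad_extension F C) (mkseq x i) in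
  [/\ bad F C st.1 st.2, mkseq x (size st.1) = st.1,
      size st.2 <= size st.1 <= i,
      forall k, size st.1 <= k <= i -> run (bad_extension F C) (mkseq x k) = st &
      forall k, size st.1 < k <= i ->
        ~ (bad_extension F C st.2 (mkseq x k) !=set0)].
Proof.
move=> b0 /=; elim: i => [|i].
  split=> // k; first by rewrite leqn0 => /andP[_ /eqP->].
  by move=> /andP[k0]; rewrite leqNgt k0.
rewrite run_mkseqS /run_step.
set st := run _ (mkseq x i) => -[bst xs /andP[st21 st1i] rk nb].
have := size_mkseq x i.+1; have := run_mkseqS (bad_extension F C) x i.
move uE: (mkseq x i.+1) => u; rewrite /run_step -/st => ru size_u; move: ru.
case: asboolP => [/(xgetPex 0)[_ be]|nbe] ru.
  split=> //=; rewrite ?size_u ?size_rcons//.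
  - by rewrite ltnS (leq_trans st21)//=.
  - by move=> k; rewrite -eqn_leq => /eqP <-; rewrite uE.
  - by move=> k /andP[ik]; rewrite leqNgt ik.
split=> //; first by rewrite st21 leqW.
- move=> k /andP[sk]; rewrite leq_eqVlt => /orP[/eqP->|ki]; first by rewrite uE.
  by apply: rk; rewrite sk.
- move=> k /andP[sk]; rewrite leq_eqVlt => /orP[/eqP->|ki]; first by rewrite uE.
  by apply: nb; rewrite sk.
Qed.

Lemma run_witness (F : set_system nat) (F_filter : Filter F)
    (C : set (baire * baire))
    (tau : seq nat * seq nat -> seq nat -> set nat) (x : baire) :
  closed C -> bad F C [::] [::] ->
  (forall st, bad F C st.1 st.2 ->
     forall x, mkseq x (size st.1) = st.1 -> follows (tau st) (size st.1) x ->
       exists2 i, size st.1 < i &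
         bad_extension F C st.2 (mkseq x i) !=set0) ->
  follows (fun u => tau (run (bad_extension F C) u) u) 0 x ->
  exists y : baire, C (x, y).
Proof.
move=> clC b0 tauP fx; set ext := bad_extension F C in tauP fx *.
pose r i := run ext (mkseq x i).
have rS i : r i.+1 = run_step ext (r i) (mkseq x i.+1) by exact: run_mkseqS.
(* Otherwise the state is constant from [i] on, so [x] follows one strategy above [st.1] and reaches
   a bad extension, which forces growth. *)
have grow i : exists j, size (r i).2 < size (r j).2.
  apply: contrapT => /forallNP ng.
  have rC k : r (i + k) = r i.
    elim: k => [|k IH]; first by rewrite addn0.
    have := ng (i + k.+1); rewrite addnS rS IH /run_step.
    by case: ifP => // _; rewrite /= size_rcons ltnSn.
  have [bi xi /andP[_ s1i] rk nb] := run_bad F C x i b0.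
  have [|k sk hk] := tauP _ bi x xi.
    move=> k sk.
    have -> : run ext (mkseq x i) = run ext (mkseq x k); last exact: fx.
    have [ki|/ltnW/subnKC <-] := leqP k i; last by rewrite -[RHS]/(r _) rC.
    by symmetry; apply: rk; apply/andP.
  have [ki|ik] := leqP k i; first by apply: (nb k) hk; apply/andP.
  have := ng k; rewrite -(subnKC ik) addSn rS rC /run_step -addSn subnKC//.
  by case: asboolP => //= _; rewrite size_rcons ltnSn.
have unbounded n : exists i, n <= size (r i).2.
  elim: n => [|n [i ni]]; first by exists 0.
  by have [j ij] := grow i; exists j; exact: leq_ltn_trans ij.
have [ix ixP] := choice unbounded.
(* At [ix n.+1] the second component has more than [n] entries, so the default 0 is never read. *)
pose y n := nth 0 (r (ix n.+1)).2 n.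
have yr i : mkseq y (size (r i).2) = (r i).2.
  apply: (@eq_from_nth _ 0); rewrite size_mkseq// => n ni.
  rewrite nth_mkseq// /y.
  have [/(run_prefix ext x)|/ltnW/(run_prefix ext x)] := leqP i (ix n.+1);
    rewrite -!/(r _) => /prefixP[z ->]; rewrite nth_cat ?ni//.
  by rewrite ixP.
exists y; apply: closed_baire2 => // n; have [i ni] := unbounded n.
have [bi xi /andP[s21 _] _ _] := run_bad F C x i b0.
(* Badness tested on the full tree yields a point of [C] close to [(x, y)]. *)
have [|x' [y' [x's y't _ Cxy]]] := bi (fun=> setT).
  by move=> u; exact: filterT.
exists x', y'; split=> //.
  rewrite -(take_mkseq _ _ _ (leq_trans ni s21)) x's -{1}xi take_mkseq//.
  exact: leq_trans s21.
by rewrite -(take_mkseq _ _ _ ni) y't -yr take_mkseq.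
Qed.

(** * The dichotomy, according to badness at the root *)

Theorem theorem8 (F : set_system nat) (F_filter : Filter F)
    (F_cofinite : forall X : set nat, cofinite_set X -> F X)
    (A : set baire) (A_Sigma11 : Sigma11 A) :
  (exists2 H : set (seq nat), HF F H & branches H `&` A = set0) \/
  (exists2 L : set (seq nat), LF F L & branches L `<=` A).
Proof.
have HF_tree sigma : (forall u, F (sigma u)) -> HF F (strategy_tree sigma).
  move=> sF; split; first exact: subtree_strategy_tree.
  by move=> s /succs_strategy_tree ->.
have [F0|F_proper] := pselect (F set0).
  (* When [F] is improper, the tree with the root as its only node lies in [HF] and has no
     branch. *)
  left; exists (strategy_tree (fun=> set0)); first exact: HF_tree.
  by rewrite -subset0 => x [/branches_strategy_tree /(_ 0 isT)].
have [C [clC ->]] := A_Sigma11.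
have [b0|/existsNP[sigma /not_implyP[sF ng]]] := pselect (bad F C [::] [::]).
  right.
  have /choice[tau tauP] : forall st : seq nat * seq nat, exists tau,
      (forall u, positive F (tau u)) /\
      (bad F C st.1 st.2 -> forall x, mkseq x (size st.1) = st.1 ->
        follows tau (size st.1) x ->
        exists2 i, size st.1 < i &
          bad_extension F C st.2 (mkseq x i) !=set0).
    move=> [s t] /=; have [b|nb] := pselect (bad F C s t).
      by have [tau tp th] := bad_reach _ F_filter F_proper _ _ _ b; exists tau.
    by exists (fun=> setT); split=> // _; rewrite /positive /= setCT.
  (* Each node uses the strategy of its current state, which concatenates the trees. *)
  exists (strategy_tree (fun u => tau (run (bad_extension F C) u) u)).
    split; first exact: subtree_strategy_tree.
    by move=> s /succs_strategy_tree ->; apply: (tauP _).1.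
  move=> x /branches_strategy_tree fx.
  by apply: (run_witness _ F_filter _ tau) fx => // st; apply: (tauP st).2.
left; exists (strategy_tree sigma); first exact: HF_tree.
rewrite -subset0 => x [/branches_strategy_tree fx [y Cxy]].
by apply: ng; exists x, y.
Qed.
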